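(* Let $G$ be a group having an invariant series $$1=G_\ell\subseteq\dots\subseteq G_{i+1}\subseteq G_i\subseteq\dots\subseteq G_1=G,$$ with every $G_i$ normal in $G$ and every quotient $G_i/G_{i+1}$ ($1\le i<\ell$) cyclic, such that each of the extensions $$1\to G_i/G_{i+1}\to G/G_{i+1}\to G/G_i\to 1\qquad(1\le i<\ell)$$ whose kernel $G_i/G_{i+1}$ is infinite is a central extension. Then $\mathcal{V}^i_1(G)\subseteq\{1\}$ for all $i>0$.
   Context: For a finitely generated group $G$, let $\mathbb{T}_G=\operatorname{Hom}(G,\mathbb{C}^* )$, with trivial character $1$; for $\rho\in\mathbb{T}_G$, $\mathbb{C}_\rho$ is the $G$-module $\mathbb{C}$ with $G$ acting through $\rho$. For $i>0$, $\mathcal{V}^i_1(G)=\{\rho\in\mathbb{T}_G\mid\dim_{\mathbb{C}}H^i(G,\mathbb{C}_\rho)\ge1\}$ (group cohomology). An extension $1\to K\to E\to B\to 1$ is central if the image of $K$ lies in the center of $E$. (A group having an invariant series with cyclic quotients as in the statement is called Poly-cyclic in the paper, with capital P because all terms are required to be normal in $G$.) *)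

(* Defs.v *)
From HB Require Import structures.
From mathcomp Require Import all_boot all_order all_algebra.
From mathcomp Require Import boolp classical_sets functions cardinality reals.
From mathcomp Require Import complex.

Set Implicit Arguments.
Unset Strict Implicit.
Unset Printing Implicit Defensive.

Import GRing.Theory.
Local Open Scope group_scope.
Local Open Scope ring_scope.
Local Open Scope quotient_scope.
Local Open Scope classical_set_scope.

(* G may be infinite. A subgroup is a boolean predicate (groupClosed); under   *)
(* the classical axioms every subgroup is of this form.                       *)
HB.mixin Record isNormalClosed (G : groupType) (N : {pred G}) := {
  gpredJn : forall x y : G, x \in N -> (x ^ y)%g \in N
}.

#[short(type="normalClosed")]
HB.structure Definition NormalClosed (G : groupType) :=
  {N of isNormalClosed G N & GroupClosed G N}.

Section QuotientGroup.
Variables (G : groupType) (N : normalClosed G).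

Definition coset_equiv (x y : G) := (x^-1 * y)%g \in N.

Lemma coset_equivP : equiv_class_of coset_equiv.
Proof.
split=> [x|x y|y x z]; rewrite /coset_equiv ?mulVg ?gpred1 //.
  by rewrite -[in RHS]gpredV invgM invgK.
by move=> xyN yzN; rewrite -[z](mulVKg y) mulgA gpredM.
Qed.

Canonical coset_equiv_equiv := EquivRelPack coset_equivP.
Canonical coset_equiv_encModRel := defaultEncModRel coset_equiv.

Definition quotient_group := {eq_quot coset_equiv}.
HB.instance Definition _ : EqQuotient G coset_equiv quotient_group :=
  EqQuotient.on quotient_group.
HB.instance Definition _ := Choice.on quotient_group.

Definition quotient_one : quotient_group := lift_cst quotient_group 1%g.
Definition quotient_mul := lift_op2 quotient_group (@monoid.mul G).
Definition quotient_inv := lift_op1 quotient_group (@monoid.inv G).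

Canonical pi_one_morph := PiConst quotient_one.

Lemma coset_equiv_repr x : coset_equiv x (repr (\pi_quotient_group x)).
Proof.
have /eqP := esym (reprK (\pi_quotient_group x)).
by rewrite piE.
Qed.

Lemma pi_invg : {morph \pi : x / x^-1%g >-> quotient_inv x}.
Proof.
move=> x; unlock quotient_inv; apply/eqP; rewrite piE /coset_equiv.
have := coset_equiv_repr x; set r := repr _; rewrite /coset_equiv invgK => h.
rewrite -gpredV invgM invgK.
by have := gpredJn _ x^-1%g h; rewrite /conjg invgK -!mulgA mulVKg.
Qed.
Canonical pi_inv_morph := PiMorph1 pi_invg.

Lemma pi_mulg : {morph \pi : x y / (x * y)%g >-> quotient_mul x y}.
Proof.
move=> x y; unlock quotient_mul; apply/eqP; rewrite piE /coset_equiv.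
have := coset_equiv_repr x; have := coset_equiv_repr y.
set y' := repr _; set x' := repr _; rewrite /coset_equiv => yy' xx'.
have -> : ((x * y)^-1 * (x' * y'))%g = ((x^-1 * x') ^ y * (y^-1 * y'))%g.
  by rewrite /conjg invgM -!mulgA mulVKg.
by rewrite gpredM// gpredJn.
Qed.
Canonical pi_mul_morph := PiMorph2 pi_mulg.

Lemma quotient_mulgA : associative quotient_mul.
Proof.
by move=> x y z; rewrite -[x]reprK -[y]reprK -[z]reprK !piE mulgA.
Qed.

Lemma quotient_mul1g : left_id quotient_one quotient_mul.
Proof. by move=> x; rewrite -[x]reprK !piE mul1g. Qed.

Lemma quotient_mulg1 : right_id quotient_one quotient_mul.
Proof. by move=> x; rewrite -[x]reprK !piE mulg1. Qed.

Lemma quotient_mulVg : left_inverse quotient_one quotient_inv quotient_mul.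
Proof. by move=> x; rewrite -[x]reprK !piE mulVg. Qed.

Lemma quotient_mulgV : right_inverse quotient_one quotient_inv quotient_mul.
Proof. by move=> x; rewrite -[x]reprK !piE mulgV. Qed.

HB.instance Definition _ := isGroup.Build quotient_group quotient_mulgA
  quotient_mul1g quotient_mulg1 quotient_mulVg quotient_mulgV.

(* H/N, as a subset of G/N (H need not contain N) *)
Definition quotient_set (H : {pred G}) : set quotient_group :=
  [set \pi_quotient_group x | x in [set x | x \in H]].

End QuotientGroup.

Arguments quotient_set {G} N H.

Definition cyclic_set (G : groupType) (A : set G) :=
  exists a : G, A = [set x | exists n : nat, x = (a ^+ n)%g \/ x = (a ^- n)%g].

Definition group_center (G : groupType) : set G :=
  [set z | forall x, commute z x].
Arguments group_center : clear implicits.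

Record mul_group (F : fieldType) :=
  MulGroup { mul_group_val :> F; _ : mul_group_val != 0 }.

Section MulGroup.
Variable F : fieldType.

HB.instance Definition _ := [isSub for @mul_group_val F].
HB.instance Definition _ := [Choice of mul_group F by <:].

Implicit Types a b : mul_group F.

Definition mul_group_one : mul_group F := MulGroup (oner_neq0 F).

Fact mul_group_mul_subproof a b : val a * val b != 0.
Proof. by rewrite mulf_neq0// (valP a, valP b). Qed.
Definition mul_group_mul a b := MulGroup (mul_group_mul_subproof a b).

Fact mul_group_inv_subproof a : (val a)^-1 != 0.
Proof. by rewrite invr_eq0 (valP a). Qed.
Definition mul_group_inv a := MulGroup (mul_group_inv_subproof a).

Fact mul_group_mulA : associative mul_group_mul.
Proof. by move=> a b c; apply: val_inj; rewrite /= mulrA. Qed.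
Fact mul_group_mul1 : left_id mul_group_one mul_group_mul.
Proof. by move=> a; apply: val_inj; rewrite /= mul1r. Qed.
Fact mul_group_mulr1 : right_id mul_group_one mul_group_mul.
Proof. by move=> a; apply: val_inj; rewrite /= mulr1. Qed.
Fact mul_group_mulV : left_inverse mul_group_one mul_group_inv mul_group_mul.
Proof. by move=> a; apply: val_inj; rewrite /= mulVf// (valP a). Qed.
Fact mul_group_mulrV : right_inverse mul_group_one mul_group_inv mul_group_mul.
Proof. by move=> a; apply: val_inj; rewrite /= mulfV// (valP a). Qed.

HB.instance Definition _ := isGroup.Build (mul_group F) mul_group_mulA
  mul_group_mul1 mul_group_mulr1 mul_group_mulV mul_group_mulrV.

End MulGroup.

(* Hom(G, F^* ); preservation of inverses follows *)
Definition char_group (F : fieldType) (G : groupType) :=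
  UMagmaMorphism.type G (mul_group F).

Definition trivial_char (F : fieldType) (G : groupType) : char_group F G :=
  one_fun (mul_group F).
Arguments trivial_char : clear implicits.

(* An alias of W that carries the proof, so that it is a canonical subspace. *)
Definition submod_of (K : fieldType) (V : lmodType K) (W : {pred V})
  (subW : GRing.subsemimod_closed W) : {pred V} := W.

HB.instance Definition _ (K : fieldType) (V : lmodType K) (W : {pred V})
    (subW : GRing.subsemimod_closed W) :=
  GRing.isSubmodClosed.Build K V (submod_of subW) subW.

Section QuotientLmod.
Variables (K : fieldType) (V : lmodType K) (W : {pred V}).
Variable subW : GRing.subsemimod_closed W.

Definition quot_lmod := Quotient.quot (submod_of subW).
HB.instance Definition _ := GRing.Zmodule.on quot_lmod.

Definition quot_scale (a : K) := lift_op1 quot_lmod ( *:%R a).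

Lemma pi_scale a : {morph \pi : x / a *: x >-> quot_scale a x}.
Proof.
move=> x; unlock quot_scale; apply/eqP; rewrite -Quotient.idealrBE.
by rewrite -scalerBr rpredZ// Quotient.idealrBE reprK.
Qed.
Canonical pi_scale_morph a := PiMorph1 (pi_scale a).

Fact quot_scaleA a b (u : quot_lmod) :
  quot_scale a (quot_scale b u) = quot_scale (a * b) u.
Proof. by rewrite -[u]reprK !piE scalerA. Qed.

Fact quot_scale1 : left_id 1 quot_scale.
Proof. by move=> u; rewrite -[u]reprK !piE scale1r. Qed.

Fact quot_scaleDr : right_distributive quot_scale +%R.
Proof.
by move=> a u v; rewrite -[u]reprK -[v]reprK !piE scalerDr.
Qed.

Fact quot_scaleDl (u : quot_lmod) : {morph quot_scale^~ u : a b / a + b}.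
Proof. by move=> a b; rewrite -[u]reprK !piE scalerDl. Qed.

HB.instance Definition _ := GRing.Zmodule_isLmodule.Build K quot_lmod
  quot_scaleA quot_scale1 quot_scaleDr quot_scaleDl.

End QuotientLmod.

(* dim V >= d, also meaningful when V is infinite-dimensional *)
Definition dim_ge (K : fieldType) (V : lmodType K) (d : nat) :=
  exists v : 'I_d -> V, forall c : 'I_d -> K,
    \sum_(i < d) c i *: v i = 0 -> forall i, c i = 0.

(* Group cohomology is computed from inhomogeneous cochains. By convention    *)
(* the only coboundary in degree 0 is 0.                                      *)
Record gmodule (K : fieldType) (G : groupType) := GModule {
  gmodule_sort :> lmodType K;
  gact : G -> gmodule_sort -> gmodule_sort;
  gact1 : forall v, gact 1%g v = v;
  gactM : forall g h v, gact (g * h)%g v = gact g (gact h v);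
  gact_linear : forall g, linear (gact g)
}.

Section GroupCohomology.
Variables (K : fieldType) (G : groupType) (M : gmodule K G).

Definition cochain (n : nat) := ('I_n -> G) -> M.
HB.instance Definition _ n := GRing.Lmodule.on (cochain n).

(* (g_0, ..., g_n) |-> (g_0, ..., g_i * g_(i+1), ..., g_n) *)
Definition merge_at n (g : 'I_n.+1 -> G) (i : 'I_n) : 'I_n -> G := fun j =>
  let gj := g (widen_ord (leqnSn n) j) in
  let gj1 := g (lift ord0 j) in
  if (j < i)%N then gj else if j == i then (gj * gj1)%g else gj1.

Definition coboundary n (f : cochain n) : cochain n.+1 := fun g =>
  gact (g ord0) (f (fun j => g (lift ord0 j)))
  + \sum_(i < n) (-1) ^+ i.+1 *: f (merge_at g i)
  + (-1) ^+ n.+1 *: f (fun j => g (widen_ord (leqnSn n) j)).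

Fact coboundary_linear n : linear (@coboundary n).
Proof.
move=> a u v; apply/funext => g.
have E m (p q : cochain m) h : (a *: p + q) h = a *: p h + q h by [].
rewrite E /coboundary E gact_linear E scalerDr !scalerA (mulrC _ a) -!scalerA.
under eq_bigr do rewrite E scalerDr scalerA (mulrC _ a) -scalerA.
rewrite big_split/= -scaler_sumr !scalerDr.
by rewrite [in LHS](addrACA (a *: _)) [in LHS](addrACA (_ + _)).
Qed.

HB.instance Definition _ n := GRing.isLinear.Build K (cochain n)
  (cochain n.+1) *:%R (@coboundary n) (@coboundary_linear n).

Definition is_cocycle n : {pred cochain n} := fun f => `[< coboundary f = 0 >].

Fact is_cocycle_submod n : GRing.subsemimod_closed (@is_cocycle n).
Proof.
split; [split=> [|f h]|move=> a f]; rewrite !unfold_in /is_cocycle.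
- by apply/asboolP; rewrite raddf0.
- by move=> /asboolP df /asboolP dh; apply/asboolP; rewrite raddfD/= df dh addr0.
- by move=> /asboolP df; apply/asboolP; rewrite linearZ/= df scaler0.
Qed.

Record cocycle n := Cocycle { cocycle_val :> cochain n;
  _ : cocycle_val \in @is_cocycle n }.
HB.instance Definition _ n := [isSub for @cocycle_val n].
HB.instance Definition _ n := [Choice of cocycle n by <:].
HB.instance Definition _ n :=
  GRing.SubChoice_isSubLmodule.Build K (cochain n) (@is_cocycle n) (cocycle n)
    (is_cocycle_submod n).

Definition is_coboundary n : {pred cocycle n} :=
  match n with
  | 0 => fun z => `[< val z = 0 :> cochain 0 >]
  | m.+1 => fun z => `[< exists f : cochain m, coboundary f = val z >]
  end.

Fact is_coboundary_submod n : GRing.subsemimod_closed (@is_coboundary n).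
Proof.
case: n => [|n]; (split; [split=> [|y z]|move=> a z]);
  rewrite !unfold_in /is_coboundary.
- by apply/asboolP; rewrite raddf0.
- by move=> /asboolP y0 /asboolP z0; apply/asboolP; rewrite raddfD/= y0 z0 addr0.
- by move=> /asboolP z0; apply/asboolP; rewrite linearZ/= z0 scaler0.
- by apply/asboolP; exists 0; rewrite !raddf0.
- move=> /asboolP[f df] /asboolP[h dh]; apply/asboolP.
  by exists (f + h); rewrite !raddfD/= df dh.
- move=> /asboolP[f df]; apply/asboolP.
  by exists (a *: f); rewrite !linearZ/= df.
Qed.

Definition group_cohomology n : lmodType K :=
  quot_lmod (@is_coboundary_submod n).

End GroupCohomology.

Section CharVariety.
Variables (F : fieldType) (G : groupType).

Section CharModule.
Variable rho : char_group F G.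

Definition char_act (g : G) (v : F^o) : F^o := val (rho g) * v.

Fact char_act1 v : char_act 1%g v = v.
Proof. by rewrite /char_act gmulf1 mul1r. Qed.

Fact char_actM g h v : char_act (g * h)%g v = char_act g (char_act h v).
Proof. by rewrite /char_act gmulfM mulrA. Qed.

Fact char_act_linear g : linear (char_act g).
Proof. by move=> a u v; rewrite /char_act mulrDr; congr (_ + _); exact: mulrCA. Qed.

Definition char_module : gmodule F G :=
  GModule char_act1 char_actM char_act_linear.

End CharModule.

Definition char_variety (i d : nat) : set (char_group F G) :=
  [set rho | dim_ge (group_cohomology (char_module rho) i) d].

End CharVariety.

Arguments char_variety : clear implicits.

(* Main.v *)
Require Import Defs.
From HB Require Import structures.
From mathcomp Require Import all_boot all_order all_algebra.
From mathcomp Require Import boolp classical_sets functions cardinality reals.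
From mathcomp Require Import complex.

(** Write [shift M] for Map(G, M) with (g phi)(x) = phi(x g) - x phi(g), so that
    H^(n+1)(G, M) = H^n(G, shift M): every vanishing statement becomes a statement
    about crossed homomorphisms into iterated shifts. Let E be an extension of B
    with cyclic kernel K = <t>, and let E act on M by a nontrivial character c.
    If H^1(K, shift^n M) = 0 for all n, then M is E-acyclic as soon as M^K is
    B-acyclic. This applies when c(t) <> 1, since then M^K = 0, and when K is
    finite, by averaging. If K is infinite, central and c(t) = 1, then
    shift M satisfies the hypothesis, because (shift M)^K is an extension of M by
    shift M over B, and H^1(E, M) = 0 because a crossed homomorphism takes t to an
    invariant of M. Climbing along the quotients G/G_i gives the theorem. *)

Set Implicit Arguments.
Unset Strict Implicit.
Unset Printing Implicit Defensive.

Import Order.TTheory GRing.Theory Num.Theory.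
Local Open Scope ring_scope.
Local Open Scope complex_scope.
Local Open Scope classical_set_scope.

(** * Deciding identities in abelian groups *)

Inductive zterm := ZVar of nat | ZAdd of zterm & zterm | ZOpp of zterm | ZZero.

Fixpoint zeval (V : zmodType) (e : seq V) t : V :=
  match t with
  | ZVar i => e`_i
  | ZAdd t u => zeval e t + zeval e u
  | ZOpp t => - zeval e t
  | ZZero => 0
  end.

Fixpoint zcoef t (i : nat) : int :=
  match t with
  | ZVar j => (i == j)%:R
  | ZAdd t u => zcoef t i + zcoef u i
  | ZOpp t => - zcoef t i
  | ZZero => 0
  end.

Lemma zevalE (V : zmodType) (e : seq V) t :
  zeval e t = \sum_(i < size e) e`_i *~ zcoef t i.
Proof.
elim: t => [j|t IHt u IHu|t IHt|] /=.
- have [j_lt|j_ge] := ltnP j (size e).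
    rewrite (bigD1 (Ordinal j_lt)) //= eqxx mulr1z big1 ?addr0 // => i.
    by rewrite -val_eqE /= => /negPf ->.
  by rewrite nth_default // big1 // => i _; rewrite ltn_eqF // (leq_trans (ltn_ord i)).
- by rewrite IHt IHu -big_split; apply: eq_bigr => i _; rewrite mulrzDr.
- by rewrite IHt -sumrN; apply: eq_bigr => i _; rewrite mulrNz.
- by rewrite big1.
Qed.

(** Once the atoms form an explicit list, the hypothesis is a closed boolean, so [zmod_eq]
    discharges it by computation. *)
Lemma zeval_eq (V : zmodType) (e : seq V) t u :
    all (fun i => zcoef t i == zcoef u i) (iota 0 (size e)) ->
  zeval e t = zeval e u.
Proof.
move=> /allP tu; rewrite !zevalE; apply: eq_bigr => i _.
by rewrite (eqP (tu _ _)) // mem_iota ltn_ord.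
Qed.

(* Atoms are compared up to conversion, since the same operation may be
   reached through several canonical instances. *)
Ltac zindex x e :=
  match e with
  | ?y :: _ => let _ := match goal with _ => unify x y end in constr:(0%N)
  | _ :: ?e' => let n := zindex x e' in constr:(n.+1)
  end.

Ltac zinsert x e :=
  match e with
  | _ => let _ := zindex x e in e
  | _ => constr:(x :: e)
  end.

Ltac zatoms t e :=
  match t with
  | @GRing.add _ ?x ?y => let e' := zatoms x e in zatoms y e'
  | @GRing.opp _ ?x => zatoms x e
  | @GRing.zero _ => e
  | ?x => zinsert x e
  end.

Ltac zreify t e :=
  match t with
  | @GRing.add _ ?x ?y =>
      let x' := zreify x e in let y' := zreify y e in constr:(ZAdd x' y')
  | @GRing.opp _ ?x => let x' := zreify x e in constr:(ZOpp x')
  | @GRing.zero _ => constr:(ZZero)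
  | ?x => let n := zindex x e in constr:(ZVar n)
  end.

Ltac zmod_eq :=
  match goal with
  | |- @eq ?T ?x ?y =>
      let e0 := zatoms x (@nil T) in
      let e := zatoms y e0 in
      let t := zreify x e in
      let u := zreify y e in
      refine (@zeval_eq _ e t u _); vm_compute; reflexivity
  end.

(** * Linear representations and their first cohomology *)

(* The identity need not act as the identity: [shift] below is not unital. *)
Record rep (F : fieldType) (G : groupType) := Rep {
  rep_sort :> lmodType F;
  ract : G -> rep_sort -> rep_sort;
  ractM : forall g h v, ract (g * h)%g v = ract g (ract h v);
  ract_linear : forall g, linear (ract g)
}.

Section Representations.
Variables (F : fieldType) (G : groupType).
Implicit Types M A X C : rep F G.

Lemma ractD M g (u v : M) : ract g (u + v) = ract g u + ract g v.
Proof. by have := ract_linear g 1 u v; rewrite !scale1r. Qed.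

Lemma ract0 M g : ract g (0 : M) = 0.
Proof. by apply: (addrI (ract g 0)); rewrite -ractD !addr0. Qed.

Lemma ractN M g (u : M) : ract g (- u) = - ract g u.
Proof. by apply: (addrI (ract g u)); rewrite -ractD !subrr ract0. Qed.

Lemma ractZ M g a (u : M) : ract g (a *: u) = a *: ract g u.
Proof. by have := ract_linear g a u 0; rewrite !addr0 ract0 addr0. Qed.

Definition ractE := (ractD, ractN, ract0).

Definition crossed M (f : G -> M) := forall g h, f (g * h)%g = f g + ract g (f h).

Definition H1_zero M :=
  forall f : G -> M, crossed f -> exists v, forall g, f g = ract g v - v.

(** Without unitality a crossed homomorphism can be nonzero at 1; this lemma and the next one
    control [f 1]. *)
Lemma crossed_act1 M (f : G -> M) g : crossed f -> ract 1%g (f g) = f g - f 1%g.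
Proof. by move=> /(_ 1%g g); rewrite mul1g => {2}->; rewrite addrC addKr. Qed.

Lemma crossed_at1 M (f : G -> M) g : crossed f -> ract g (f 1%g) = 0.
Proof.
by move=> /(_ g 1%g); rewrite mulg1 => fg; apply: (addrI (f g)); rewrite -fg addr0.
Qed.

Section Shift.
Variable M : rep F G.

Definition shift_act (g : G) (phi : G -> M) : G -> M :=
  fun x => phi (x * g)%g - ract x (phi g).

Fact shift_actM g h phi :
  shift_act (g * h)%g phi = shift_act g (shift_act h phi).
Proof.
apply/funext => x; rewrite /shift_act mulgA !ractE -ractM; zmod_eq.
Qed.

Fact shift_act_linear g : linear (shift_act g).
Proof.
move=> a u v; apply/funext => x.
change (a *: u (x * g)%g + v (x * g)%g - ract x (a *: u g + v g) =
  a *: (u (x * g)%g - ract x (u g)) + (v (x * g)%g - ract x (v g))).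
rewrite ractD ractZ scalerBr; zmod_eq.
Qed.

(* A cochain in n+1 variables with values in M is a cochain in the last n
   variables with values in [shift], and the two coboundaries differ by a sign;
   so H^(n+1)(G, M) is H^n(G, shift). *)
Definition shift := Rep shift_actM shift_act_linear.

End Shift.

(** By dimension shifting, this is the vanishing of H^n(G, M) for all n > 0. *)
Definition acyclic M := forall n, H1_zero (iter n shift M).

Lemma acyclic_shift M : acyclic M -> acyclic (shift M).
Proof. by move=> acM n; rewrite -iterSr; exact: (acM n.+1). Qed.

(** * Short exact sequences *)

Definition equivariant A X (i : A -> X) := forall g a, i (ract g a) = ract g (i a).

Definition additive_fun A X (i : A -> X) := forall a b, i (a + b) = i a + i b.

Lemma additive_funB A X (i : A -> X) :
  additive_fun i -> forall a b, i (a - b) = i a - i b.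
Proof. by move=> iD a b; apply: (addIr (i b)); rewrite -iD !subrK. Qed.

Record short_exact A X C (i : A -> X) (p : X -> C) := ShortExact {
  se_iD : additive_fun i;
  se_pD : additive_fun p;
  se_iG : equivariant i;
  se_pG : equivariant p;
  se_inj : injective i;
  se_pi : forall a, p (i a) = 0;
  se_ker : forall x, p x = 0 -> exists a, x = i a;
  se_surj : forall c, exists x, c = p x
}.

(** Map(G, -) is exact, since preimages can be chosen pointwise. *)
Lemma shift_exact A X C (i : A -> X) (p : X -> C) : short_exact i p ->
  short_exact (fun phi : shift A => i \o phi : shift X)
              (fun phi : shift X => p \o phi : shift C).
Proof.
move=> [iD pD iG pG i_inj pi ker surj]; split.
- by move=> a b; apply/funext => x; exact: iD.
- by move=> a b; apply/funext => x; exact: pD.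
- by move=> g a; apply/funext => x; rewrite /= /shift_act (additive_funB iD) iG.
- by move=> g a; apply/funext => x; rewrite /= /shift_act (additive_funB pD) pG.
- by move=> a b ab; apply/funext => x; apply: i_inj; exact: (congr1 (@^~ x) ab).
- by move=> a; apply/funext => x; exact: pi.
- move=> phi phi0; have /choice[psi psiP] : forall x, exists a, phi x = i a.
    by move=> x; apply: ker; exact: (congr1 (@^~ x) phi0).
  by exists psi; apply/funext.
- move=> phi; have /choice[psi psiP] : forall x, exists a, phi x = p a.
    by move=> x; exact: surj.
  by exists psi; apply/funext.
Qed.

(** Exactness of H^1(A) -> H^1(X) -> H^1(C) in the middle. *)
Lemma H1_zero_ext A X C (i : A -> X) (p : X -> C) : short_exact i p ->
  H1_zero A -> H1_zero C -> H1_zero X.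
Proof.
move=> [iD pD iG pG i_inj pi ker surj].
have iB := additive_funB iD; have pB := additive_funB pD.
move=> HA HC f fM.
have [c cP] : exists c, forall g, p (f g) = ract g c - c.
  by apply: HC => g h; rewrite fM pD pG.
have [w cE] := surj c; subst c.
have /choice[a aP] : forall g, exists a, f g - (ract g w - w) = i a.
  by move=> g; apply: ker; rewrite !pB pG cP subrr.
have [b bP] : exists b, forall g, a g = ract g b - b.
  apply: HA => g h; apply: i_inj; rewrite iD iG -!aP fM ractM !ractE; zmod_eq.
exists (i b + w) => g.
have := aP g; rewrite bP iB iG ractD => E.
rewrite -[LHS](subrK (ract g w - w)) E; zmod_eq.
Qed.

(** Exactness of H^1(X) -> H^1(C) -> H^2(A), with H^2(A) read as H^1 of [shift A]. *)
Lemma H1_zero_coker A X C (i : A -> X) (p : X -> C) : short_exact i p ->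
  H1_zero (shift A) -> H1_zero X -> H1_zero C.
Proof.
move=> [iD pD iG pG i_inj pi ker surj].
have iB := additive_funB iD; have pB := additive_funB pD.
move=> HA HX f fM.
have /choice[f' f'P] : forall g, exists x, f g = p x by move=> g; exact: surj.
(* The defect of the lift [f'] is a 2-cocycle with values in A; as a function of its first variable
   it is a crossed homomorphism into [shift A]. *)
have /choice[a aP] : forall gh : G * G, exists a,
    f' gh.1 + ract gh.1 (f' gh.2) - f' (gh.1 * gh.2)%g = i a.
  by move=> [g h] /=; apply: ker; rewrite pB pD pG -!f'P fM subrr.
have {}aP g h : i (a (g, h)) = f' g + ract g (f' h) - f' (g * h)%g.
  by rewrite -(aP (g, h)).
have [phi phiP] : exists phi : shift A, forall h,
    (fun x => a (x, h)) = ract h phi - phi.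
  apply: (HA (fun h x => a (x, h))) => g h; apply/funext => x.
  change (a (x, (g * h)%g) = a (x, g) + (a ((x * g)%g, h) - ract x (a (g, h)))).
  apply: i_inj; rewrite iD iB iG !aP !ractE -!ractM !mulgA; zmod_eq.
have {}phiP x h : a (x, h) = phi (x * h)%g - ract x (phi h) - phi x.
  by have := congr1 (@^~ x) (phiP h).
have [v vP] : exists v, forall g, f' g + i (phi g) = ract g v - v.
  apply: HX => g h; have := aP g h.
  rewrite phiP !iB iG ractD => E.
  rewrite -[f' (g * h)%g](subKr (f' g + ract g (f' h))) -E; zmod_eq.
(* The first summand is 0, so the witness is [p v]; the correction [i (phi g)] dies in C. *)
exists (- p (i 0) + p v) => g; rewrite pi oppr0 add0r -pG -pB -vP pD pi.
by rewrite addr0.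
Qed.

Lemma iter_shift_exact n A X C (i : A -> X) (p : X -> C) : short_exact i p ->
  exists i' p', @short_exact (iter n shift A) (iter n shift X) (iter n shift C) i' p'.
Proof.
move=> ip; elim: n => [|n [i' [p' /shift_exact ip']]]; first by exists i, p.
by do 2!eexists; exact: ip'.
Qed.

Lemma acyclic_ext A X C (i : A -> X) (p : X -> C) : short_exact i p ->
  acyclic A -> acyclic C -> acyclic X.
Proof.
move=> /iter_shift_exact ip acA acC n; have [i' [p' ip']] := ip n.
exact: H1_zero_ext ip' (acA n) (acC n).
Qed.

Lemma acyclic_coker A X C (i : A -> X) (p : X -> C) : short_exact i p ->
  acyclic A -> acyclic X -> acyclic C.
Proof.
move=> /iter_shift_exact ip acA acX n; have [i' [p' ip']] := ip n.
exact: H1_zero_coker ip' (acA n.+1) (acX n).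
Qed.

Lemma acyclic_zero M : (forall v : M, v = 0) -> acyclic M.
Proof.
move=> M0 n; have {}M0 : forall v : iter n shift M, v = 0.
  elim: n => [|n IHn] //= v; apply/funext => x; exact: IHn.
by move=> f _; exists 0 => g; rewrite [LHS]M0 [RHS]M0.
Qed.

(* Up to the action of 1, an equivariant retraction of M -> Map(G, M),
   v |-> (x |-> x v), where G acts on maps by right translation. *)
Definition coind_retract M (sg : (G -> M) -> M) :=
  [/\ forall u v, sg (u + v) = sg u + sg v,
      forall g (u : G -> M), sg (fun x => u (x * g)%g) = ract g (sg u) &
      forall v : M, sg (fun x => ract x v) = ract 1%g v].

(** Applying [sg] to [f (x g) = f x + x (f g)], as functions of x, gives
    [g (sg f) = sg f + f g - f 1]; the term [- f 1] of the witness, killed by every g, absorbs the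
    last summand. *)
Lemma coind_retract_H1 M sg : @coind_retract M sg -> H1_zero M.
Proof.
move=> [sgD sgG sg1] f fM; exists (sg f - f 1%g) => g.
rewrite !ractE -sgG crossed_at1 // subr0.
have -> : (fun x => f (x * g)%g) = f + (fun x => ract x (f g)).
  by apply/funext => x; exact: fM.
rewrite sgD sg1 crossed_act1 //; zmod_eq.
Qed.

(** The new retraction is a composite of two equivariant maps: [psi] applies
    [phi |-> phi 1 - 1 (sg phi)] pointwise, landing in Map(G, M), and [u |-> (y |-> u y - y (u 1))]
    carries Map(G, M) to [shift M]. *)
Lemma coind_retract_shift M sg : @coind_retract M sg ->
  exists sg', @coind_retract (shift M) sg'.
Proof.
move=> [sgD sgG sg1].
have sgB u v : sg (u - v) = sg u - sg v.
  by apply: (addIr (sg v)); rewrite -sgD !subrK.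
pose psi (Phi : G -> shift M) x := Phi x 1%g - ract 1%g (sg (Phi x)).
exists (fun Phi y => psi Phi y - ract y (psi Phi 1%g)); split.
- move=> u v; apply/funext => y.
  have E x : psi (u + v) x = psi u x + psi v x.
    have -> : psi (u + v) x = u x 1%g + v x 1%g - ract 1%g (sg (u x + v x)) by [].
    rewrite sgD ractD /psi; zmod_eq.
  change (psi (u + v) y - ract y (psi (u + v) 1%g) =
    psi u y - ract y (psi u 1%g) + (psi v y - ract y (psi v 1%g))).
  rewrite !E ractD; zmod_eq.
- move=> g u; apply/funext => y.
  change (psi u (y * g)%g - ract y (psi u (1 * g)%g) =
    psi u (y * g)%g - ract (y * g)%g (psi u 1%g)
      - ract y (psi u g - ract g (psi u 1%g))).
  move: (psi u) => w; rewrite mul1g !ractE -ractM; zmod_eq.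
- move=> phi; apply/funext => y /=.
  have E x : psi (fun x => ract x phi) x = phi x - ract x (sg phi).
    rewrite /psi /=.
    have -> : shift_act x phi = (fun y => phi (y * x)%g) - (fun y => ract y (phi x)).
      by [].
    rewrite sgB sgG sg1.
    have -> : ((fun y => phi (y * x)%g) - (fun y => ract y (phi x))) 1%g =
      phi (1 * x)%g - ract 1%g (phi x) by [].
    rewrite mul1g !ractE -!ractM !mul1g; zmod_eq.
  rewrite !E !ractE -ractM !mulg1 /shift_act mulg1; zmod_eq.
Qed.

Lemma coind_retract_acyclic M sg : @coind_retract M sg -> acyclic M.
Proof.
move=> sgP n; suff [sg' /coind_retract_H1] :
  exists sg', @coind_retract (iter n shift M) sg' by [].
elim: n => [|n [sg' /coind_retract_shift]] //; by exists sg.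
Qed.

Section Coinduced.
Variable V : lmodType F.

Definition coind_act (g : G) (u : G -> V) : G -> V := fun x => u (x * g)%g.

Fact coind_actM g h u : coind_act (g * h)%g u = coind_act g (coind_act h u).
Proof. by apply/funext => x; rewrite /coind_act mulgA. Qed.

Fact coind_act_linear g : linear (coind_act g).
Proof. by []. Qed.

Definition coind := Rep coind_actM coind_act_linear.

(** The retraction evaluates each inner map at 1. *)
Lemma coind_acyclic : acyclic coind.
Proof.
apply: (@coind_retract_acyclic coind (fun Phi x => Phi x 1%g)); split=> //.
by move=> v; apply/funext => x; rewrite /= /coind_act mul1g mulg1.
Qed.

End Coinduced.

Section NullSummand.
Variables (X : rep F G) (V : lmodType F).

Definition null_act (g : G) (v : V) : V := 0.

Fact null_actM g h v : null_act (g * h)%g v = null_act g (null_act h v).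
Proof. by []. Qed.

Fact null_act_linear g : linear (null_act g).
Proof. by move=> a u v; rewrite scaler0 addr0. Qed.

Definition null_rep := Rep null_actM null_act_linear.

Definition add_null_act (g : G) (v : X * V) : X * V := (ract g v.1, 0).

Fact add_null_actM g h v :
  add_null_act (g * h)%g v = add_null_act g (add_null_act h v).
Proof. by rewrite /add_null_act ractM. Qed.

Fact add_null_act_linear g : linear (add_null_act g).
Proof.
move=> a u v; rewrite /add_null_act /= ract_linear; congr (_, _).
by rewrite /= scaler0 addr0.
Qed.

Definition add_null := Rep add_null_actM add_null_act_linear.

(** The zero map is a retraction for the null representation, because 1 acts on it as 0; and X is
    the cokernel of its inclusion. *)
Lemma acyclic_add_null : acyclic add_null -> acyclic X.
Proof.
have null_ac : acyclic null_rep.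
  by apply: (@coind_retract_acyclic null_rep (fun=> 0)); split=> // *; rewrite addr0.
apply: (@acyclic_coker null_rep add_null X (fun v => (0, v)) (fun u => u.1) _ null_ac).
split=> //.
- by move=> a b; congr (_, _); rewrite addr0.
- by move=> g a; congr (_, _); rewrite ract0.
- by move=> a b [].
- by move=> [x v] /= ->; exists v.
- by move=> x; exists (x, 0).
Qed.

End NullSummand.

End Representations.

(** * Group extensions *)

Section Extension.
Variables (F : fieldType) (E B : groupType) (pi : E -> B) (s : B -> E).
Hypothesis piM : {morph pi : x y / (x * y)%g}.
Hypothesis sK : cancel s pi.
Implicit Type M : rep F E.

Let pi1 : pi 1%g = 1%g.
Proof. by apply: (mulgI (pi 1%g)); rewrite -piM !mulg1. Qed.

Let piV x : pi x^-1%g = (pi x)^-1%g.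
Proof. by apply: (mulgI (pi x)); rewrite -piM !mulgV pi1. Qed.

Let pi_ker_conj k x : pi k = 1%g -> pi (k ^ x)%g = 1%g.
Proof. by move=> k1; rewrite /conjg !piM k1 mul1g piV mulVg. Qed.

Section Invariants.
Variable M : rep F E.

Definition inv_pred : {pred M} :=
  fun v => `[< forall k, pi k = 1%g -> ract k v = v >].

Fact inv_pred_submod : GRing.subsemimod_closed inv_pred.
Proof.
split; [split=> [|u v]|move=> a v]; rewrite !unfold_in /inv_pred.
- by apply/asboolP => k _; rewrite ract0.
- move=> /asboolP uP /asboolP vP; apply/asboolP => k k1.
  by rewrite ractD uP ?vP.
- by move=> /asboolP vP; apply/asboolP => k k1; rewrite ractZ vP.
Qed.

Record inv_sort := InvSort { inv_val :> M; _ : inv_val \in inv_pred }.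
HB.instance Definition _ := [isSub for @inv_val].
HB.instance Definition _ := [Choice of inv_sort by <:].
HB.instance Definition _ :=
  GRing.SubChoice_isSubLmodule.Build F M inv_pred inv_sort inv_pred_submod.

Lemma inv_predP (v : M) :
  reflect (forall k, pi k = 1%g -> ract k v = v) (v \in inv_pred).
Proof. exact: asboolP. Qed.

Lemma inv_valP (v : inv_sort) k : pi k = 1%g -> ract k (inv_val v) = inv_val v.
Proof. by move=> k1; have /inv_predP -> := valP v. Qed.

Lemma inv_valD (u v : inv_sort) : inv_val (u + v) = inv_val u + inv_val v.
Proof. exact: (raddfD (val : inv_sort -> M)). Qed.

Lemma inv_valB (u v : inv_sort) : inv_val (u - v) = inv_val u - inv_val v.
Proof. exact: (raddfB (val : inv_sort -> M)). Qed.

Lemma ract_coset (v : inv_sort) x y : pi x = pi y -> ract x (inv_val v) = ract y (inv_val v).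
Proof.
move=> xy; rewrite -(mulVKg y x) ractM inv_valP // piM piV xy mulVg //.
Qed.

Fact inv_act_subproof b (v : inv_sort) : ract (s b) (inv_val v) \in inv_pred.
Proof.
apply/inv_predP => k k1.
have -> : ract k (ract (s b) (inv_val v)) = ract (s b) (ract (k ^ s b)%g (inv_val v)).
  by rewrite -!ractM conjgC.
by rewrite inv_valP // pi_ker_conj.
Qed.

(** By [ract_coset] the action does not depend on the section [s]. It is unital, as [s 1] lies in
    the kernel. *)
Definition inv_act b (v : inv_sort) := InvSort (inv_act_subproof b v).

Fact inv_actM b c v : inv_act (b * c)%g v = inv_act b (inv_act c v).
Proof.
by apply: val_inj; rewrite /= -ractM; apply: ract_coset; rewrite piM !sK.
Qed.

Fact inv_act_linear b : linear (inv_act b).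
Proof.
by move=> a u v; apply: val_inj; rewrite /= ract_linear.
Qed.

Definition inv_rep : rep F B := Rep inv_actM inv_act_linear.

End Invariants.
Arguments inv_pred M _ : clear implicits.

(* H^1(ker pi, M) = 0, for cocycles that extend to E in the weak sense needed
   below. *)
Definition relH1_zero M := forall f : E -> M,
    (forall x k, pi k = 1%g -> f (x * k)%g = f x + ract x (f k)) ->
  exists v, forall k, pi k = 1%g -> f k = ract k v - v.

(** A crossed homomorphism vanishing on K = ker pi is constant on cosets of K and takes values in
    M^K, so it is inflated from B. *)
Lemma H1_zero_inflation M (f : E -> M) : H1_zero (inv_rep M) -> crossed f ->
  (forall k, pi k = 1%g -> f k = 0) -> exists v, forall g, f g = ract g v - v.
Proof.
move=> HB fM f0.
have fr x k : pi k = 1%g -> f (x * k)%g = f x.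
  by move=> k1; rewrite fM (f0 k) // ract0 addr0.
have fpi x y : pi x = pi y -> f x = f y.
  by move=> xy; rewrite -(mulVKg y x) fr // piM piV xy mulVg.
have finv x : f x \in inv_pred M.
  apply/inv_predP => k k1.
  have := fM k x; rewrite (f0 k) // add0r => <-.
  by rewrite conjgC fr // pi_ker_conj.
have [w wP] : exists w : inv_rep M,
    forall b, InvSort (finv (s b)) = ract b w - w :> inv_rep M.
  apply: (HB (fun b => InvSort (finv (s b)))) => b c; apply: val_inj.
  rewrite /= -fM; apply: fpi.
  by rewrite piM !sK.
exists (inv_val w) => g.
have := congr1 (@inv_val M) (wP (pi g)); rewrite inv_valB /= => gE.
by rewrite (fpi g (s (pi g))) ?sK // gE; congr (_ - _); apply: ract_coset; rewrite sK.
Qed.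

(** Inflation-restriction: subtracting a coboundary that agrees with f on K leaves a cocycle
    vanishing on K. *)
Lemma H1_zero_extension M :
  relH1_zero M -> H1_zero (inv_rep M) -> H1_zero M.
Proof.
move=> HK HB f fM; have [v vP] := HK f (fun x k _ => fM x k).
have [w wP] : exists w, forall g, f g - (ract g v - v) = ract g w - w.
  apply: H1_zero_inflation => //.
    by move=> g h; rewrite fM !ractE ractM; zmod_eq.
  by move=> k k1; rewrite vP // subrr.
exists (v + w) => g; rewrite -[LHS](subrK (ract g v - v)) wP ractD; zmod_eq.
Qed.

(* The sequence M^K -> Map(B, M) -> (shift M)^K, whose middle term is coinduced. *)
Lemma acyclic_inv_shift M : relH1_zero M ->
  acyclic (inv_rep M) -> acyclic (inv_rep (shift M)).
Proof.
move=> HK acM.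
pose q (u : B -> M) : E -> M := fun x => u (pi x) - ract x (u 1%g).
have q_inv u : q u \in inv_pred (shift M).
  apply/inv_predP => k k1; apply/funext => x.
  rewrite /= /shift_act /q !piM k1 mulg1 !ractE -!ractM; zmod_eq.
pose i (v : inv_rep M) : coind B M := fun b => ract (s b) (inv_val v).
pose p (u : coind B M) : inv_rep (shift M) := InvSort (q_inv u).
apply: (@acyclic_coker _ _ _ _ _ i p _ acM (@coind_acyclic _ _ _)); split.
- by move=> a b; apply/funext => x; rewrite /i inv_valD ractD.
- move=> a b; apply: val_inj; apply/funext => x.
  change (a (pi x) + b (pi x) - ract x (a 1%g + b 1%g) =
    a (pi x) - ract x (a 1%g) + (b (pi x) - ract x (b 1%g))).
  rewrite ractD; zmod_eq.
- move=> b v; apply/funext => c; rewrite /i /= /coind_act -ractM.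
  by apply: ract_coset; rewrite piM !sK.
- move=> b u; apply: val_inj; apply/funext => x.
  rewrite /= /shift_act /q /= /coind_act piM sK mul1g !ractE -ractM; zmod_eq.
- move=> u v uv; apply: val_inj => /=.
  have := congr1 (@^~ 1%g) uv; rewrite /i.
  by rewrite !inv_valP // sK.
- move=> v; apply: val_inj; apply/funext => x /=.
  rewrite /q /i (@inv_valP M v (s 1%g)) ?sK //.
  by rewrite (@ract_coset M v (s (pi x)) x) ?sK // subrr.
- move=> u u0.
  have uE x : u (pi x) = ract x (u 1%g).
    apply/eqP; rewrite -subr_eq0; apply/eqP.
    exact: (congr1 (fun w => @inv_val (shift M) w x) u0).
  have u1 : u 1%g \in inv_pred M.
    by apply/inv_predP => k k1; rewrite -uE k1.
  exists (InvSort u1); apply/funext => b.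
  by rewrite /i /= -uE sK.
- move=> [phi phiP]; have phiM x k : pi k = 1%g -> phi (x * k)%g = phi x + ract x (phi k).
    move=> k1; have /inv_predP/(_ k k1) := phiP.
    move=> /(congr1 (@^~ x)); rewrite /= /shift_act => <-; zmod_eq.
  (* On K, [phi] is the coboundary of v. Removing [x v] from [phi x] leaves a function of the coset
     of x, which is the preimage sought. *)
  have [v vP] := HK phi phiM.
  have phi1 : phi 1%g = ract 1%g v - v by rewrite vP.
  pose u x := phi x - ract x v.
  have u1 : u 1%g = - v by rewrite /u phi1; zmod_eq.
  have uM x y : pi x = pi y -> u x = u y.
    move=> xy; have k1 : pi (y^-1 * x)%g = 1%g by rewrite piM piV xy mulVg.
    rewrite -(mulVKg y x) /u (phiM _ _ k1) (vP _ k1) ractM !ractE; zmod_eq.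
  exists (fun b => u (s b)); apply: val_inj; apply/funext => x /=.
  rewrite /q (uM _ x) ?sK // (uM (s 1%g) 1%g) ?sK // u1 /u ractE; zmod_eq.
Qed.

(** [acyclic_inv_shift] propagates B-acyclicity of the invariants to every iterated shift;
    inflation-restriction then applies to each of them. *)
Lemma acyclic_extension M : (forall n, relH1_zero (iter n (@shift F E) M)) ->
  acyclic (inv_rep M) -> acyclic M.
Proof.
move=> HK acM n.
have /(_ 0) : acyclic (inv_rep (iter n (@shift F E) M)).
  by elim: n => //= n IHn; exact: acyclic_inv_shift.
exact: H1_zero_extension.
Qed.

End Extension.

Arguments inv_pred {F E B} pi M _.

(** * Extensions with cyclic kernel *)

(** M is any space with a scalar action, not just a line, so that the property for B applies
    directly to M^K. *)
Definition nontriv_acyclic (F : fieldType) (G : groupType) :=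
  forall (M : rep F G) (c : G -> F), (forall g (v : M), ract g v = c g *: v) ->
    c 1%g = 1 -> {morph c : x y / (x * y)%g >-> x * y} ->
    (exists g, c g != 1) -> acyclic M.

Section CyclicKernel.
Variables (F : numFieldType) (E B : groupType) (pi : E -> B) (s : B -> E).
Hypothesis piM : {morph pi : x y / (x * y)%g}.
Hypothesis sK : cancel s pi.
Variable t : E.
Hypothesis pi_t : pi t = 1%g.
Hypothesis kerE : forall k, pi k = 1%g -> exists n, k = (t ^+ n)%g \/ k = (t ^- n)%g.
Implicit Type M : rep F E.

Let weakly_crossed M (f : E -> M) :=
  forall x k, pi k = 1%g -> f (x * k)%g = f x + ract x (f k).

Let pi1 : pi 1%g = 1%g.
Proof. by apply: (mulgI (pi 1%g)); rewrite -piM !mulg1. Qed.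

Let pi_tX n : pi (t ^+ n)%g = 1%g.
Proof. by elim: n => [|n IHn]; rewrite ?expg0 ?pi1 // expgS piM pi_t IHn mulg1. Qed.

Let weakly_crossed_ker M (f : E -> M) k :
  weakly_crossed f -> f t = 0 -> pi k = 1%g -> f k = 0.
Proof.
move=> fM ft0; have f1 : f 1%g = 0.
  by have := fM 1%g t pi_t; rewrite mul1g ft0 ract0 addr0 => <-.
have fX n : f (t ^+ n)%g = 0.
  elim: n => [|n IHn]; first by rewrite expg0.
  by rewrite expgSr fM // IHn ft0 ract0 addr0.
move=> /kerE[n [->|->]] //.
by have := fM (t ^- n)%g _ (pi_tX n); rewrite mulVg f1 fX ract0 addr0 => <-.
Qed.

(** On the powers of t, a crossed homomorphism is determined by its value at t. *)
Lemma relH1_zero_gen M :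
    (forall f : E -> M, weakly_crossed f -> exists v, f t = ract t v - v) ->
  relH1_zero pi M.
Proof.
move=> Ht f fM; have [v vP] := Ht f fM; exists v => k k1.
apply/eqP; rewrite -subr_eq0; apply/eqP.
apply: (@weakly_crossed_ker _ (fun x => f x - (ract x v - v))) => //.
  by move=> x h h1; rewrite fM // !ractE ractM; zmod_eq.
by rewrite vP subrr.
Qed.

(** Summing [f (t^(i+1)) = f t + t (f (t^i))] over a full period gives [(m+1) f t = S - t S], and
    m+1 is invertible in characteristic 0. *)
Lemma relH1_zero_finite m M : (t ^+ m.+1)%g = 1%g -> relH1_zero pi M.
Proof.
move=> tm; apply: relH1_zero_gen => f fM.
pose S := \sum_(i < m.+1) f (t ^+ i)%g.
have ractS : ract t S = \sum_(i < m.+1) ract t (f (t ^+ i)%g).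
  by rewrite /S; elim/big_rec2: _ => [|i u v _ <-]; rewrite ?ract0 // ractD.
have S_shift : S = m.+1%:R *: f t + ract t S.
  rewrite ractS scaler_nat -[X in f t *+ X]card_ord -sumr_const -big_split /=.
  under [RHS]eq_bigr => i _ do rewrite -fM // -expgS.
  by rewrite big_ord_recr /= tm /S big_ord_recl addrC.
exists (- (m.+1%:R^-1 *: S)).
have E1 : m.+1%:R *: f t = S - ract t S by rewrite {1}S_shift addrK.
by rewrite !ractE ractZ opprK addrC -scalerBr -E1 scalerA mulVf ?scale1r ?pnatr_eq0.
Qed.

Section InfiniteOrder.
Hypothesis t_inf : forall m, (t ^+ m.+1)%g != 1%g.

Let tz (z : int) : E := match z with Posz n => (t ^+ n)%g | Negz n => (t ^- n.+1)%g end.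

Let tzS z : tz (z + 1) = (tz z * t)%g.
Proof.
case: z => n; first by rewrite -PoszD addn1 /= expgSr.
case: n => [|n]; first by rewrite /= expg0 expg1 mulVg.
have -> : Negz n.+1 + 1 = Negz n.
  by rewrite !NegzE -[n.+2]addn1 PoszD opprD addrNK.
by rewrite /= [in RHS]expgS invgM -mulgA mulVg mulg1.
Qed.

Let tzD z n : tz (z + Posz n) = (tz z * t ^+ n)%g.
Proof.
elim: n => [|n IHn]; first by rewrite addr0 expg0 mulg1.
by rewrite -addn1 PoszD addrA tzS IHn addn1 expgSr mulgA.
Qed.

Let tz_inj : injective tz.
Proof.
have tz_le z z' : z <= z' -> tz z = tz z' -> z = z'.
  move=> zz'; have -> : z' = z + Posz `|z' - z|%N.
    by rewrite gez0_abs ?subr_ge0 // addrCA subrr addr0.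
  case: `|z' - z|%N => [|n]; first by rewrite addr0.
  rewrite tzD => tzE; case/negP: (t_inf n); apply/eqP.
  by apply: (mulgI (tz z)); rewrite mulg1.
move=> z z' zz'; have [/tz_le -> //|/ltW /tz_le ->//] := leP z z'.
Qed.

(* The exponent of t in x, relative to a choice of coset representatives. *)
Lemma infinite_order_exponent :
  exists nu : E -> int, nu 1%g = 0 /\ forall x, nu (x * t)%g = nu x + 1.
Proof.
have /choice[nu nuP] : forall x, exists z, ((s (pi x))^-1 * x)%g = tz z.
  move=> x; have [|n [->|->]] := kerE (k := ((s (pi x))^-1 * x)%g).
  - by apply: (mulgI (pi (s (pi x)))); rewrite -piM mulVKg sK mulg1.
  - by exists (Posz n).
  - case: n => [|n]; last by exists (Negz n).
    by exists 0; rewrite /= expg0 invg1.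
have nuS x : nu (x * t)%g = nu x + 1.
  by apply: tz_inj; rewrite tzS -!nuP piM pi_t mulg1 mulgA.
exists (fun x => nu x - nu 1%g); split=> [|x]; first by rewrite subrr.
by rewrite nuS addrAC.
Qed.

(** The equation to solve is [phi (x t) - x (phi t) - phi x = psi x]. Each coset of the powers of t
    is an infinite line with coordinate [nu]; summing [psi] along it from the point where [nu] is 0
    gives [phi0 (x t) - phi0 x = psi x]. *)
Lemma relH1_zero_shift M : relH1_zero pi (shift M).
Proof.
have [nu [_ nuS]] := infinite_order_exponent.
apply: relH1_zero_gen => f _; pose psi := f t.
pose phi0 x : M := match nu x with
  | Posz n => \sum_(i < n) psi (x * t ^- i.+1)%g
  | Negz n => - \sum_(i < n.+1) psi (x * t ^+ i)%g
  end.
have phi0S x : phi0 (x * t)%g = phi0 x + psi x.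
  rewrite /phi0 nuS; case: (nu x) => n.
    rewrite -PoszD addn1 /= big_ord_recl /= expg1 mulgK addrC.
    by congr (_ + _); apply: eq_bigr => i _; rewrite [in LHS]expgSr invgM -!mulgA mulVKg.
  have -> : Negz n + 1 = - Posz n by rewrite NegzE -addn1 PoszD opprD subrK.
  rewrite big_ord_recl /= expg0 mulg1 opprD [RHS]addrC addNKr.
  case: n => [|n]; first by rewrite [LHS]big_ord0 big_ord0 oppr0.
  rewrite -NegzE; congr (- _); apply: eq_bigr => i _.
  by rewrite expgS mulgA.
(* Subtracting the constant makes the solution vanish at t, which removes the term [x (phi t)]. *)
exists (fun x => phi0 x - phi0 t); apply/funext => x.
change (psi x = phi0 (x * t)%g - phi0 t - ract x (phi0 t - phi0 t)
  - (phi0 x - phi0 t)).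
by rewrite phi0S subrr ract0; zmod_eq.
Qed.

End InfiniteOrder.

Section Character.
Variables (M : rep F E) (c : E -> F).
Hypothesis actE : forall g v, ract g v = c g *: v :> M.
Hypothesis c1 : c 1%g = 1.
Hypothesis cM : {morph c : x y / (x * y)%g >-> x * y}.

Let c_ker (ct1 : c t = 1) k : pi k = 1%g -> c k = 1.
Proof.
have cX n : c (t ^+ n)%g = 1.
  by elim: n => [|n IHn]; rewrite ?expg0 // expgS cM ct1 IHn mulr1.
move=> /kerE[n [->|->]] //.
by have := cM (t ^+ n)%g (t ^- n)%g; rewrite mulgV c1 cX mul1r.
Qed.

Let c_pi (ct1 : c t = 1) x y : pi x = pi y -> c x = c y.
Proof.
move=> xy; rewrite -(mulVKg y x) cM (c_ker ct1 (k := (y^-1 * x)%g)) ?mulr1 //.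
by apply: (mulgI (pi y)); rewrite -piM mulVKg mulg1.
Qed.

Lemma acyclic_kernel_nontrivial : c t != 1 -> acyclic M.
Proof.
move=> ct1; have ct0 : c t - 1 != 0 by rewrite subr_eq0.
apply: (acyclic_extension (piM := piM) (sK := sK)); last first.
  apply: acyclic_zero => v; apply: val_inj => /=.
  have := inv_valP v pi_t; rewrite actE => /eqP.
  by rewrite -subr_eq0 -{2}[inv_val v]scale1r -scalerBl scaler_eq0 (negPf ct0) => /eqP.
move=> [|n].
  apply: relH1_zero_gen => f _; exists ((c t - 1)^-1 *: f t).
  by rewrite actE -{2}[_ *: f t]scale1r -scalerBl scalerA mulfV ?scale1r.
(* On a proper shift t no longer acts by the scalar [c t], so the order of t decides which vanishing
   result applies. *)
have [[m tm]|t_inf] := pselect (exists m, (t ^+ m.+1)%g = 1%g).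
  exact: relH1_zero_finite tm.
apply: relH1_zero_shift => m; apply/eqP => tm; apply: t_inf; by exists m.
Qed.

Section TrivialOnKernel.
Hypothesis ct1 : c t = 1.
Hypothesis c_nontrivial : exists g, c g != 1.
Hypothesis acB : nontriv_acyclic F B.

Let acyclic_inv : acyclic (inv_rep piM sK M).
Proof.
have [g cg] := c_nontrivial; apply: (acB (c := c \o s)).
- by move=> b v; apply: val_inj; rewrite /= actE.
- by rewrite /= -c1; apply: c_pi => //; rewrite sK pi1.
- by move=> a b; rewrite /= -cM; apply: c_pi => //; rewrite piM !sK.
- by exists (pi g); rewrite /= (c_pi ct1 (y := g)) // sK.
Qed.

Lemma acyclic_kernel_finite m : (t ^+ m.+1)%g = 1%g -> acyclic M.
Proof.
move=> tm; apply: (acyclic_extension (piM := piM) (sK := sK)) => // n.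
exact: relH1_zero_finite tm.
Qed.

Section Infinite.
Hypothesis t_inf : forall m, (t ^+ m.+1)%g != 1%g.
Hypothesis t_central : forall x, commute t x.

Let ker_act k (v : M) : pi k = 1%g -> ract k v = v.
Proof. by move=> k1; rewrite actE c_ker // scale1r. Qed.

Let all_inv (v : M) : v \in inv_pred pi M.
Proof. by apply/inv_predP => k; exact: ker_act. Qed.

(* A K-invariant element of [shift M] restricts to a homomorphism K -> M, which
   is determined by its value at t; this gives an exact sequence
   shift M -> (shift M)^K -> M of B-modules, up to the part of shift M on which
   1 acts as 0, for which the null summand compensates. *)
Let acyclic_inv_shift_infinite : acyclic (inv_rep piM sK (shift M)).
Proof.
have [nu [nu1 nuS]] := infinite_order_exponent t_inf.
have nuK x k : pi k = 1%g -> nu (x * k)%g = nu x + nu k.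
  have nuX y n : nu (y * t ^+ n)%g = nu y + n%:Z.
    elim: n => [|n IHn]; first by rewrite expg0 mulg1 addr0.
    by rewrite expgSr mulgA nuS IHn -addn1 PoszD addrA.
  have nuV y n : nu (y * t ^- n)%g = nu y - n%:Z.
    by have := nuX (y * t ^- n)%g n; rewrite mulgVK => ->; rewrite addrK.
  move=> /kerE[n [->|->]].
    by have := nuX 1%g n; rewrite mul1g nu1 add0r nuX => ->.
  by have := nuV 1%g n; rewrite mul1g nu1 add0r nuV => ->.
have nut : nu t = 1 by have := nuS 1%g; rewrite mul1g nu1 add0r.
pose u_ (u : B -> inv_rep piM sK M) x : M := inv_val (u (pi x)) - ract x (inv_val (u 1%g)).
have u_inv u : u_ u \in inv_pred pi (shift M).
  apply/inv_predP => k k1; apply/funext => x.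
  rewrite /= /shift_act /u_ piM k1 mulg1 ractM !ractE (ker_act _ k1); zmod_eq.
(* The first component kills exactly the maps [b |-> b z], on which B acts as 0 in the shift; the
   second component records z. *)
pose i (u : shift (inv_rep piM sK M)) : add_null (inv_rep piM sK (shift M)) M :=
  (InvSort (u_inv u), inv_val (u 1%g)).
pose p (w : add_null (inv_rep piM sK (shift M)) M) : inv_rep piM sK M :=
  InvSort (all_inv (inv_val w.1 t)).
have inv_shiftM (w : inv_rep piM sK (shift M)) x k : pi k = 1%g ->
    inv_val w (x * k)%g = inv_val w x + ract x (inv_val w k).
  by move=> k1; rewrite -{2}(inv_valP w k1) /= /shift_act subrK.
apply: (@acyclic_add_null _ _ _ M).
apply: (@acyclic_ext _ _ _ _ _ i p _ (acyclic_shift acyclic_inv) acyclic_inv); split.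
- move=> u v; congr (_, _); apply: val_inj; apply/funext => x.
  change (inv_val (u (pi x) + v (pi x)) - ract x (inv_val (u 1%g + v 1%g)) =
    inv_val (u (pi x)) - ract x (inv_val (u 1%g))
      + (inv_val (v (pi x)) - ract x (inv_val (v 1%g)))).
  rewrite !inv_valD ractD; zmod_eq.
- by move=> u v; apply: val_inj.
- move=> b u; congr (_, _); last first.
    change (inv_val (u (1 * b)%g) - ract (s 1%g) (inv_val (u b)) = 0).
    by rewrite mul1g (inv_valP _ (sK 1%g)) subrr.
  apply: val_inj; apply/funext => x.
  change (inv_val (u (pi x * b)%g) - ract (s (pi x)) (inv_val (u b))
    - ract x (inv_val (u (1 * b)%g) - ract (s 1%g) (inv_val (u b)))
    = inv_val (u (pi (x * s b)%g)) - ract (x * s b)%g (inv_val (u 1%g))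
      - ract x (inv_val (u (pi (s b))) - ract (s b) (inv_val (u 1%g)))).
  rewrite piM !sK (ract_coset piM (u b) (sK (pi x))) (inv_valP _ (sK 1%g)) mul1g.
  rewrite !ractE -ractM; zmod_eq.
(* Centrality makes evaluation at t equivariant: [w (t x) = w (x t) = w x + x (w t)], while t acts
   trivially on M. *)
- move=> b [w z]; apply: val_inj.
  change (inv_val w (t * s b)%g - ract t (inv_val w (s b)) = ract (s b) (inv_val w t)).
  rewrite t_central (inv_shiftM w _ _ pi_t) (ker_act _ pi_t); zmod_eq.
- move=> u v uv; apply/funext => b; apply: val_inj => /=.
  have u1 : inv_val (u 1%g) = inv_val (v 1%g) by exact: (congr1 snd uv).
  have := congr1 (fun w : add_null (inv_rep piM sK (shift M)) M => inv_val (M := shift M) w.1 (s b)) uv.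
  by rewrite /= /u_ u1 sK => /addIr.
- by move=> u; apply: val_inj; rewrite /= /u_ pi_t ker_act // subrr.
(* If w vanishes at t, it vanishes on K and descends to B; adding [b z] then sets the value at 1 to
   z. *)
- move=> [w z] w0.
  have wt : inv_val w t = 0 by exact: (congr1 (@inv_val _ _ _ _ M) w0).
  have wK k : pi k = 1%g -> inv_val w k = 0.
    by apply: weakly_crossed_ker wt; exact: inv_shiftM.
  have w_pi x y : pi x = pi y -> inv_val w x = inv_val w y.
    move=> xy; have k1 : pi (y^-1 * x)%g = 1%g.
      by apply: (mulgI (pi y)); rewrite -piM mulVKg mulg1.
    by rewrite -(mulVKg y x) (inv_shiftM w _ _ k1) (wK _ k1) ract0 addr0.
  exists (fun b => InvSort (all_inv (inv_val w (s b) + ract (s b) z))).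
  congr (_, _); last by rewrite /= wK ?sK // add0r ker_act ?sK.
  apply: val_inj; apply/funext => x; rewrite /= /u_ /=.
  rewrite (w_pi (s (pi x)) x) ?sK // (wK (s 1%g)) ?sK // add0r (ker_act _ (sK 1%g)).
  by rewrite (ract_coset piM (InvSort (all_inv z)) (sK (pi x))) addrK.
- move=> m.
  (* Since [nu] is additive along K and [nu t = 1], this map is K-invariant in the shift and takes
     the value m at t. *)
  pose phi x : M := (nu x)%:~R *: ract x (inv_val m).
  have phi_inv : phi \in inv_pred pi (shift M).
    apply/inv_predP => k k1; apply/funext => x.
    rewrite /= /shift_act /phi nuK // ractM ractZ !(ker_act _ k1).
    by rewrite intrD scalerDl addrK.
  exists (InvSort phi_inv, 0); apply: val_inj.
  by rewrite /= /phi nut scale1r ker_act.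
Qed.

Lemma acyclic_kernel_infinite : acyclic M.
Proof.
(* K acts trivially on M, so H^1(K, M) need not vanish: the extension criterion is used on
   [shift M], and H^1(E, M) is treated directly. *)
have acS : acyclic (shift M).
  apply: (acyclic_extension (piM := piM) (sK := sK)); last first.
    exact: acyclic_inv_shift_infinite.
  by move=> n; rewrite -iterSr; exact: relH1_zero_shift.
case=> [|n]; last by rewrite iterSr; exact: acS.
move=> f fM; apply: (H1_zero_inflation (piM := piM) (sK := sK)) => //.
  exact: (@acyclic_inv 0%N).
have ft0 : f t = 0.
  (* Comparing [f (t g)] with [f (g t)] gives [(c g - 1) f t = 0]. *)
  have [g cg] := c_nontrivial.
  have := fM g t; rewrite -t_central fM !actE ct1 scale1r addrC => /addrI/eqP.
  rewrite -subr_eq0 -{1}[f t]scale1r -scalerBl scaler_eq0 subr_eq0 eq_sym.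
  by rewrite (negPf cg) => /eqP.
by move=> k; apply: weakly_crossed_ker ft0 => x h _; exact: fM.
Qed.

End Infinite.
End TrivialOnKernel.
End Character.

Lemma nontriv_acyclic_extension :
  (exists m, (t ^+ m.+1)%g = 1%g) \/ (forall x, commute t x) ->
  nontriv_acyclic F B -> nontriv_acyclic F E.
Proof.
move=> t_cases acB M c actE c1 cM c_nontrivial.
have [ct1|ct1] := eqVneq (c t) 1; last exact: acyclic_kernel_nontrivial actE ct1.
have [[m tm]|t_inf] := pselect (exists m, (t ^+ m.+1)%g = 1%g).
  exact: acyclic_kernel_finite actE c1 cM ct1 c_nontrivial acB _ tm.
have t_central : forall x, commute t x by case: t_cases.
apply: acyclic_kernel_infinite actE c1 cM ct1 c_nontrivial acB _ t_central.
by move=> m; apply/eqP => tm; apply: t_inf; exists m.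
Qed.

End CyclicKernel.

(** * Inhomogeneous cochains *)

Section Cochains.
Variables (F : fieldType) (G : groupType).
Implicit Type M : rep F G.

Definition gcons n (x : G) (g : 'I_n -> G) : 'I_n.+1 -> G :=
  fun i => if unlift ord0 i is Some j then g j else x.

Lemma gcons0 n x (g : 'I_n -> G) : gcons x g ord0 = x.
Proof. by rewrite /gcons unlift_none. Qed.

Lemma gcons_lift n x (g : 'I_n -> G) j : gcons x g (lift ord0 j) = g j.
Proof. by rewrite /gcons liftK. Qed.

Lemma gcons_eta n (g : 'I_n.+1 -> G) : gcons (g ord0) (fun j => g (lift ord0 j)) = g.
Proof. by apply/funext => i; rewrite /gcons; case: unliftP => [j|] ->. Qed.

(* The differential of Defs, without the assumption that 1 acts as the identity. *)
Definition rep_coboundary M n (f : ('I_n -> G) -> M) : ('I_n.+1 -> G) -> M :=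
  fun g => ract (g ord0) (f (fun j => g (lift ord0 j)))
    + \sum_(i < n) (-1) ^+ i.+1 *: f (merge_at g i)
    + (-1) ^+ n.+1 *: f (fun j => g (widen_ord (leqnSn n) j)).

Lemma rep_coboundaryN M n (f : ('I_n -> G) -> M) g :
  rep_coboundary (fun h => - f h) g = - rep_coboundary f g.
Proof.
rewrite /rep_coboundary ractN !opprD -sumrN scalerN.
by congr (_ + _ + _); apply: eq_bigr => i _; rewrite scalerN.
Qed.

Lemma merge_at_gcons0 n x (g : 'I_n.+1 -> G) :
  merge_at (gcons x g) ord0 = gcons (x * g ord0)%g (fun j => g (lift ord0 j)).
Proof.
apply/funext => j; rewrite /merge_at; case: (unliftP ord0 j) => [k|] -> /=.
  by rewrite !gcons_lift.
have -> : widen_ord (leqnSn n.+1) ord0 = ord0 :> 'I_n.+2 by apply: val_inj.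
by rewrite gcons_lift !gcons0.
Qed.

Lemma widen_lift n (j : 'I_n) :
  widen_ord (leqnSn n.+1) (lift ord0 j) = lift ord0 (widen_ord (leqnSn n) j).
Proof. exact: val_inj. Qed.

Lemma merge_at_gcons_lift n x (g : 'I_n.+1 -> G) i :
  merge_at (gcons x g) (lift ord0 i) = gcons x (merge_at g i).
Proof.
apply/funext => j; rewrite /merge_at; case: (unliftP ord0 j) => [k|] -> /=.
  by rewrite gcons_lift widen_lift !gcons_lift (inj_eq (@lift_inj _ _)).
have -> : widen_ord (leqnSn n.+1) ord0 = ord0 :> 'I_n.+2 by apply: val_inj.
by rewrite !gcons0.
Qed.

Lemma front_gcons n x (g : 'I_n.+1 -> G) :
  (fun j => gcons x g (widen_ord (leqnSn n.+1) j))
    = gcons x (fun j => g (widen_ord (leqnSn n) j)).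
Proof.
apply/funext => j; case: (unliftP ord0 j) => [k|] ->.
  by rewrite widen_lift !gcons_lift.
have -> : widen_ord (leqnSn n.+1) ord0 = ord0 :> 'I_n.+2 by apply: val_inj.
by rewrite !gcons0.
Qed.

(** With x split off, the terms [x (f g)] and [- f (x g_0, ...)] form minus the shift action of
    [g_0]; the remaining terms have their index raised by one, hence the same sign. *)
Lemma rep_coboundary_shift M n (f : ('I_n.+1 -> G) -> M) x (g : 'I_n.+1 -> G) :
  rep_coboundary f (gcons x g) =
  - (rep_coboundary (M := shift M) (fun h y => f (gcons y h)) g : G -> M) x.
Proof.
have sum_app (u : 'I_n -> G -> M) : (\sum_i u i) x = \sum_i u i x.
  by elim/big_rec2: _ => [|i v w _ <-].
have -> : (rep_coboundary (M := shift M) (fun h y => f (gcons y h)) g : G -> M) x =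
    f (gcons (x * g ord0)%g (fun j => g (lift ord0 j))) - ract x (f g)
    + \sum_(i < n) (-1) ^+ i.+1 *: f (gcons x (merge_at g i))
    + (-1) ^+ n.+1 *: f (gcons x (fun j => g (widen_ord (leqnSn n) j))).
  change (shift_act (g ord0) (fun y => f (gcons y (fun j => g (lift ord0 j)))) x
    + (\sum_(i < n) ((-1) ^+ i.+1 *: (fun y => f (gcons y (merge_at g i))) : G -> M)) x
    + (-1) ^+ n.+1 *: f (gcons x (fun j => g (widen_ord (leqnSn n) j)))
    = f (gcons (x * g ord0)%g (fun j => g (lift ord0 j))) - ract x (f g)
    + \sum_(i < n) (-1) ^+ i.+1 *: f (gcons x (merge_at g i))
    + (-1) ^+ n.+1 *: f (gcons x (fun j => g (widen_ord (leqnSn n) j)))).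
  by rewrite sum_app /shift_act gcons_eta.
rewrite /rep_coboundary big_ord_recl /= gcons0 merge_at_gcons0 front_gcons.
under eq_fun do rewrite gcons_lift.
under eq_bigr do rewrite merge_at_gcons_lift.
rewrite expr1 scaleN1r exprS mulN1r scaleNr.
under eq_bigr do rewrite exprS mulN1r scaleNr.
rewrite sumrN; zmod_eq.
Qed.

(** Dimension shifting, by induction on n for all M: a cocycle of degree n+2 in M is one of degree
    n+1 in [shift M], and degree 1 is [H1_zero]. *)
Lemma acyclic_coboundary M n (f : ('I_n.+1 -> G) -> M) :
  acyclic M -> (forall g, rep_coboundary f g = 0) ->
  exists h, forall g, rep_coboundary h g = f g.
Proof.
elim: n M f => [|n IHn] M f acM df.
  pose g0 (i : 'I_0) : G := 1%g.
  have g0E (g : 'I_0 -> G) : g = g0 by apply/funext => -[].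
  have [v vP] : exists v, forall x, f (gcons x g0) = ract x v - v.
    apply: (acM 0%N) => x y.
    have := df (gcons x (gcons y g0)); rewrite rep_coboundary_shift.
    rewrite /rep_coboundary big_ord0 addr0 expr1 scaleN1r gcons0.
    rewrite [fun j => gcons y g0 (lift ord0 j)]g0E.
    rewrite [fun j => gcons y g0 (widen_ord (leqnSn 0) j)]g0E.
    change (- (f (gcons (x * y)%g g0) - ract x (f (gcons y g0)) - f (gcons x g0)) = 0 ->
      f (gcons (x * y)%g g0) = f (gcons x g0) + ract x (f (gcons y g0))).
    by move=> /eqP; rewrite oppr_eq0 subr_eq0 subr_eq => /eqP.
  exists (fun=> v) => g; rewrite /rep_coboundary big_ord0 addr0 expr1 scaleN1r -vP.
  by rewrite -[in RHS](gcons_eta g); congr (f (gcons _ _)); rewrite [RHS]g0E.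
have [h hP] : exists h : ('I_n -> G) -> shift M,
    forall g, rep_coboundary h g = fun y => f (gcons y g).
  apply: IHn (acyclic_shift acM) _ => g; apply/funext => x.
  by apply: oppr_inj; rewrite -rep_coboundary_shift df oppr0.
(* The sign cancels the one in [rep_coboundary_shift]. *)
pose h' (g : 'I_n.+1 -> G) : M := - h (fun j => g (lift ord0 j)) (g ord0).
exists h' => g; rewrite -(gcons_eta g) rep_coboundary_shift.
have -> : (fun u y => h' (gcons y u)) = (fun u => - h u) :> (('I_n -> G) -> shift M).
  apply/funext => u; apply/funext => y; rewrite /h' gcons0; congr (- h _ _).
  by apply/funext => j; rewrite gcons_lift.
rewrite rep_coboundaryN hP; exact: opprK.
Qed.

End Cochains.

(** * Acyclicity and characteristic varieties *)

Section Characters.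
Local Open Scope quotient_scope.

Lemma char_group_ext (F : fieldType) (G : groupType) (rho sg : char_group F G) :
  rho =1 sg -> rho = sg.
Proof.
case: rho sg => f [[fM] [f1]] [g [[gM] [g1]]] /= /funext fg; subst g.
by rewrite (Prop_irrelevance gM fM) (Prop_irrelevance g1 f1).
Qed.

Definition char_rep (F : fieldType) (G : groupType) (rho : char_group F G) : rep F G :=
  Rep (@gactM _ _ (char_module rho)) (@gact_linear _ _ (char_module rho)).

(** A single independent class would be nonzero, but every cocycle of positive degree is a
    coboundary. *)
Lemma acyclic_char_variety (F : fieldType) (G : groupType) (rho : char_group F G) n :
  acyclic (char_rep rho) -> ~ char_variety F G n.+1 1 rho.
Proof.
move=> ac [v vP]; suff v0 : v ord0 = 0.
  have /eqP : (1 : F) = 0 by apply: (vP (fun=> 1) _ ord0); rewrite big_ord1 v0 scaler0.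
  by rewrite oner_eq0.
rewrite -[v ord0]reprK; set z := repr _.
rewrite -(raddf0 \pi_(group_cohomology (char_module rho) n.+1)).
apply/eqP; rewrite -Quotient.idealrBE subr0 unfold_in; apply/asboolP.
have /asboolP dz := valP z.
have [h hP] := @acyclic_coboundary _ _ (char_rep rho) n (val z) ac (fun g => congr1 (@^~ g) dz).
by exists h; apply/funext.
Qed.

End Characters.

(** * Induction along the series *)

Section QuotientGroups.
Local Open Scope quotient_scope.
Variables (G : groupType).
Implicit Type N : normalClosed G.

Lemma pi_quotientE N x y :
  (\pi_(quotient_group N) x = \pi_(quotient_group N) y) <-> (x^-1 * y)%g \in N.
Proof.
split=> [/eqP|xy]; first by rewrite piE.
by apply/eqP; rewrite piE.
Qed.

Lemma pi_quotientM N x y :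
  \pi_(quotient_group N) (x * y)%g = (\pi_(quotient_group N) x * \pi_(quotient_group N) y)%g.
Proof. exact: pi_mulg. Qed.

Lemma pi_quotient1 N : \pi_(quotient_group N) 1%g = 1%g.
Proof. exact: (esym (piE (pi_one_morph N))). Qed.

(** For N contained in N' this is the projection G/N -> G/N'. With the roles exchanged, the same
    formula supplies the set-theoretic section. *)
Definition quotient_map (N N' : normalClosed G) (x : quotient_group N) :
  quotient_group N' := \pi_(quotient_group N') (repr x).

Variables (N N' : normalClosed G).
Hypothesis NN' : {subset N <= N'}.

Lemma quotient_mapE x :
  quotient_map N' (\pi_(quotient_group N) x) = \pi_(quotient_group N') x.
Proof.
by apply/pi_quotientE/NN'/pi_quotientE; rewrite reprK.
Qed.

Lemma quotient_mapM : {morph @quotient_map N N' : x y / (x * y)%g}.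
Proof.
move=> x y; rewrite -[x]reprK -[y]reprK -pi_quotientM !quotient_mapE.
exact: pi_quotientM.
Qed.

Lemma quotient_mapK : cancel (@quotient_map N' N) (@quotient_map N N').
Proof. by move=> x; rewrite quotient_mapE reprK. Qed.

Lemma quotient_map_ker x : quotient_map N' x = 1%g <-> quotient_set N N' x.
Proof.
split=> [x1|[y /= yN' <-]].
  exists (repr x); last exact: reprK.
  move: x1; rewrite -pi_quotient1 => /esym/pi_quotientE.
  by rewrite invg1 mul1g.
rewrite quotient_mapE -pi_quotient1; apply/esym/pi_quotientE.
by rewrite invg1 mul1g.
Qed.

End QuotientGroups.

Lemma finite_set_exp (G : groupType) (A : set G) (a : G) :
  finite_set A -> (forall n, A (a ^+ n)%g) -> exists m, (a ^+ m.+1)%g = 1%g.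
Proof.
move=> finA Aa; apply: contrapT => a_inf.
have a_le m n : (m <= n)%N -> (a ^+ m)%g = (a ^+ n)%g -> m = n.
  move=> mn; rewrite -(subnKC mn) expgnDr.
  case: (n - m)%N => [|k]; first by rewrite addn0.
  move=> E; case: a_inf; exists k.
  by apply: (mulgI (a ^+ m)%g); rewrite mulg1.
apply: infinite_nat; rewrite (_ : setT = (fun n => a ^+ n)%g @^-1` A).
  apply: finite_preimage finA => m n _ _ mn.
  by have [/a_le -> //|/ltnW/a_le -> //] := leqP m n.
by apply/seteqP; split=> n _ //=; exact: Aa.
Qed.

Lemma series_nontriv_acyclic (F : numFieldType) (G : groupType) (l : nat)
    (H : nat -> normalClosed G) :
    H 1%N =i predT ->
    (forall i, (1 <= i < l)%N -> {subset H i.+1 <= H i}) ->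
    (forall i, (1 <= i < l)%N -> cyclic_set (quotient_set (H i.+1) (H i))) ->
    (forall i, (1 <= i < l)%N ->
       infinite_set (quotient_set (H i.+1) (H i)) ->
       quotient_set (H i.+1) (H i) `<=` group_center (quotient_group (H i.+1))) ->
  forall i, (1 <= i <= l)%N -> nontriv_acyclic F (quotient_group (H i)).
Proof.
move=> H1 Hsub Hcyc Hcent; elim=> // -[_ _|i IHi /= i_lt].
  (* G/G_1 is trivial, so it has no nontrivial character. *)
  move=> M c _ c1 _ [g]; suff -> : g = 1%g by rewrite c1 eqxx.
  by rewrite -[g]reprK -pi_quotient1; apply/pi_quotientE; rewrite H1.
have {}i_lt : (1 <= i.+1 < l)%N by [].
have {}IHi := IHi (ltnW i_lt).
have [a aE] := Hcyc _ i_lt.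
have aX n : quotient_set (H i.+2) (H i.+1) (a ^+ n)%g.
  by rewrite aE; exists n; left.
have pi_a : quotient_map (H i.+1) a = 1%g.
  by apply/(quotient_map_ker (Hsub _ i_lt)); exact: (aX 1%N).
apply: (nontriv_acyclic_extension (quotient_mapM (Hsub _ i_lt))
  (quotient_mapK (Hsub _ i_lt)) pi_a _ _ IHi).
  by move=> k /(quotient_map_ker (Hsub _ i_lt)); rewrite aE.
have [/finite_set_exp/(_ aX)|inf] := pselect (finite_set (quotient_set (H i.+2) (H i.+1))).
  by left.
by right; apply: (Hcent _ i_lt inf); exact: (aX 1%N).
Qed.

Theorem theorem2p8 (R : realType) (G : groupType) (l : nat)
    (H : nat -> normalClosed G)
    (l_gt0 : (0 < l)%N)
    (H_first : H 1%N =i predT)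
    (H_last : H l =i pred1 1%g)
    (H_sub : forall i, (1 <= i < l)%N -> {subset H i.+1 <= H i})
    (H_cyclic : forall i, (1 <= i < l)%N ->
       cyclic_set (quotient_set (H i.+1) (H i)))
    (H_central : forall i, (1 <= i < l)%N ->
       infinite_set (quotient_set (H i.+1) (H i)) ->
       quotient_set (H i.+1) (H i) `<=`
         group_center (quotient_group (H i.+1))) :
  forall i, (0 < i)%N ->
    char_variety R[i] G i 1 `<=` [set trivial_char R[i] G].
Proof.
move=> [//|n] _ rho; apply: contraPP => rho_nontriv; apply: acyclic_char_variety.
have acQ : nontriv_acyclic R[i] (quotient_group (H l)).
  by apply: (series_nontriv_acyclic H_first H_sub H_cyclic H_central); rewrite l_gt0 leqnn.
(* G/G_l is isomorphic but not equal to G; the projection is handled as an extension whose kernel is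
   generated by 1. *)
have acG : nontriv_acyclic R[i] G.
  apply: (nontriv_acyclic_extension (pi_quotientM (H l)) (@reprK _ _) (pi_quotient1 (H l)) _ _ acQ).
    move=> k; rewrite -pi_quotient1 => /esym/pi_quotientE.
    rewrite invg1 mul1g H_last => /eqP ->.
    by exists 0%N; left.
  by left; exists 0%N; rewrite expg1.
apply: (acG _ (fun g => val (rho g))) => //.
- by rewrite gmulf1.
- by move=> x y; rewrite gmulfM.
- apply: contrapT => rho1; apply: rho_nontriv.
  apply: char_group_ext => g; apply: val_inj; apply: contrapT => rhog.
  by apply: rho1; exists g; apply/eqP.
Qed.
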